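(* For each $\rho\in(0,1)$ let $Y_\rho$ be a random variable with the same distribution as $\frac{\ln\rho}{\ln(1-\rho)}X_\rho$. Then $Y_\rho\to 1$ in probability as $\rho\uparrow 1$; that is, for all $\epsilon>0$, $$\lim_{\rho\to 1^-}P\bigl(|Y_\rho-1|>\epsilon\bigr)=0.$$
   Context: Frog model (single-frog case). Fix $\rho\in(0,1)$ and let $p=\frac{1}{1+\rho}\in(\tfrac12,1)$, so that $\rho=\frac{1-p}{p}$. At each site $x\in\mathbb{Z}$ with $x\ge 0$ there is initially exactly one particle (''frog''), and there are no frogs at sites $x<0$. At time $0$ the frog at the origin is active and all others are sleeping. Active frogs perform, in discrete time, simultaneously and independently of each other, nearest-neighbour random walks on $\mathbb{Z}$, each step being $+1$ with probability $p$ and $-1$ with probability $1-p$. When an active frog visits a site containing a sleeping frog, that frog becomes active and from then on performs the same kind of random walk starting from its initial location; all random walk transitions are independent. $X_\rho$ denotes a random variable with the distribution of the negative of the minimum of the set of sites visited by active frogs (this minimum is almost surely finite, and $X_\rho\ge 0$). *)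

(* Defs.v *)
From HB Require Import structures.
From mathcomp Require Import all_boot all_order all_algebra.
From mathcomp Require Import all_classical all_reals all_analysis.
From mathcomp Require Import measurable_realfun.

Set Implicit Arguments.
Unset Strict Implicit.
Unset Printing Implicit Defensive.

Import Order.TTheory GRing.Theory Num.Theory.
Import numFieldNormedType.Exports.

Local Open Scope classical_set_scope.
Local Open Scope ring_scope.

(* Mutual independence of a family of random variables: the product rule on
   every finite subfamily, listed by a duplicate-free sequence of indices. *)
Definition mutually_independent (R : realType) (d d' : measure_display)
    (T : measurableType d) (T' : measurableType d') (P : probability T R)
    (I : choiceType) (Z : I -> {RV P >-> T'}) : Prop :=
  forall (J : seq I) (A : I -> set T'), uniq J ->
    (forall i, i \in J -> measurable (A i)) ->
    P (\bigcap_(i in [set` J]) (Z i @^-1` A i)) =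
    (\prod_(i <- J) P (Z i @^-1` A i))%E.

Definition same_law (R : realType) (d1 d2 d' : measure_display)
    (T1 : measurableType d1) (T2 : measurableType d2) (T' : measurableType d')
    (P1 : probability T1 R) (P2 : probability T2 R)
    (Y1 : T1 -> T') (Y2 : T2 -> T') : Prop :=
  forall A : set T', measurable A ->
    pushforward P1 Y1 A = pushforward P2 Y2 A.

(* The frog starting at site x is named x. Its steps are indexed by the number
   k of steps it has made since it woke up: the k-th step goes to the right if
   and only if up (x, k). The walk of a frog is thus fixed before the frog is
   awake, and it is run from the waking time on. *)
Definition frog_walk (up : nat * nat -> bool) (x k : nat) : int :=
  x%:Z + \sum_(j < k) (if up (x, val j) then 1 else - 1).

(* State of the frog x at time t: None if it is asleep, and Some k if it is
   active and has made k steps, so that it stands at frog_walk up x k. *)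
Fixpoint frog_age (up : nat * nat -> bool) (t : nat) (x : nat) : option nat :=
  match t with
  | 0%N => if x == 0%N then Some 0%N else None
  | s.+1 =>
      if frog_age up s x is Some k then Some k.+1
      else if `[< exists y k : nat, frog_age up s y = Some k /\
                                    frog_walk up y k.+1 = x%:Z >]
           then Some 0%N else None
  end.

Definition frog_visited (up : nat * nat -> bool) : set int :=
  [set z | exists t x k : nat,
     frog_age up t x = Some k /\ frog_walk up x k = z].

(* The opposite of the leftmost visited site. An infimum in the extended reals
   is used, so that no value has to be made up when the set of visited sites is
   unbounded below: the result is then +oo. *)
Definition frog_depth (R : realType) (up : nat * nat -> bool) : \bar R :=
  (- ereal_inf [set (z%:~R)%:E | z in frog_visited up])%E.

(* The randomness of the model with drift parameter rho: independent steps,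
   each to the right with probability p = 1 / (1 + rho). *)
Definition frog_steps (R : realType) (d : measure_display)
    (T : measurableType d) (P : probability T R) (rho : R)
    (up : nat * nat -> {RV P >-> bool}) : Prop :=
  mutually_independent up /\
  forall i, P (up i @^-1` [set true]) = ((1 + rho)^-1)%:E.

(* Main.v *)
(* The walk with drift to the right visits every site, so almost surely every
   frog wakes up. The frog x goes at least n + x sites to the left of its start
   with probability rho ^ (n + x), hence
     P(X_rho < n) = \prod_(x >= 0) (1 - rho ^ (n + x))  for n >= 1,
   which lies between 1 - S and (1 + S)^-1 with S = rho ^ n / (1 - rho).
   For n close to c ln (1 - rho) / ln rho one has rho ^ n close to (1 - rho) ^ c
   and S close to (1 - rho) ^ (c - 1); as rho tends to 1 this vanishes if c > 1
   and is unbounded if c < 1. Infinite products are avoided by looking at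
   finitely many frogs with finitely many steps, and passing to the limit. *)
Require Import Defs.
From HB Require Import structures.
From mathcomp Require Import all_boot all_order all_algebra.
From mathcomp Require Import all_classical all_reals all_analysis.
From mathcomp Require Import measurable_realfun.
From mathcomp Require Import ring lra zify.

Set Implicit Arguments.
Unset Strict Implicit.
Unset Printing Implicit Defensive.

Import Order.TTheory GRing.Theory Num.Theory.
Import numFieldNormedType.Exports.

Local Open Scope classical_set_scope.
Local Open Scope ring_scope.

(** * Trajectories *)

Definition steps_sum (s : nat -> bool) (n : nat) : int :=
  \sum_(j < n) (if s j then 1 else - 1).

(* k is the distance still to be covered, in the direction given by b (true for
   right), and n the number of steps left. *)
Fixpoint hits (b : bool) (s : nat -> bool) (n k : nat) : bool :=
  match k, n with
  | 0, _ => true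
  | _, 0 => false
  | k'.+1, n'.+1 => hits b (fun j => s j.+1) n' (if s 0%N == b then k' else k.+1)
  end.

Lemma frog_walkE up x n :
  frog_walk up x n = x%:Z + steps_sum (fun j => up (x, j)) n.
Proof. by []. Qed.

Lemma steps_sum0 s : steps_sum s 0 = 0.
Proof. by rewrite /steps_sum big_ord0. Qed.

Lemma steps_sumS s n :
  steps_sum s n.+1 = (if s 0%N then 1 else -1) + steps_sum (fun j => s j.+1) n.
Proof. by rewrite /steps_sum big_ord_recl. Qed.

Lemma hitsS b s n k : hits b s n k -> hits b s n.+1 k.
Proof.
elim: n s k => [|n IH] s [|k] // h.
exact: (IH (fun j => s j.+1) _ h).
Qed.

Lemma hits_le b s m n k : (m <= n)%N -> hits b s m k -> hits b s n k.
Proof.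
move=> /subnK <-; elim: (n - m)%N => // j IH h.
by rewrite addSn; apply/hitsS/IH.
Qed.

Lemma hits_lower b s n j k : (j <= k)%N -> hits b s n k -> hits b s n j.
Proof.
have step : forall n s k, hits b s n k.+1 -> hits b s n k.
  by elim=> [|m IH] r [|i] //=; case: ifP => _; exact: IH.
move=> /subnK <-; elim: (k - j)%N => // i IH h.
by apply/IH/step; rewrite -addSn.
Qed.

Lemma hits_steps_sum b s n k : hits b s n k ->
  exists m, steps_sum s m = if b then k%:Z else - k%:Z.
Proof.
elim: n s k => [|n IH] s [|k] //.
- by move=> _; exists 0%N; rewrite steps_sum0; case: b.
- by move=> {IH} _; exists 0%N; rewrite steps_sum0; case: b.
move=> /IH[m hm]; exists m.+1; rewrite steps_sumS; move: hm {IH}.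
by case: b (s 0%N) => [] [] /= ->; lia.
Qed.

(** Steps have size one, so a walk that ends at or below [- k] has passed through [- k] itself. *)
Lemma steps_sum_hits s n (k : nat) : steps_sum s n <= - k%:Z -> hits false s n k.
Proof.
elim: n s k => [|n IH] s [|k] //; first by rewrite steps_sum0; lia.
rewrite steps_sumS /= => h; apply: IH.
by case: (s 0%N) h => /=; lia.
Qed.

Lemma frog_age_step up t j x k :
  frog_age up t x = Some k -> frog_age up (j + t) x = Some (j + k)%N.
Proof. by move=> h; elim: j => // j IH; rewrite !addSn /= IH. Qed.

Lemma frog_age_origin up t : frog_age up t 0 = Some t.
Proof. by rewrite -[t]addn0; apply: frog_age_step. Qed.

(** Frog 0 is awake from the start and its age is the time, so it alone wakes every frog on its
    path; chains of awakenings need not be followed. *)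
Lemma frog_wakes up (t x : nat) :
  frog_walk up 0 t = x -> exists k, frog_age up t x = Some k.
Proof.
case: t => [|t] h.
  move: h; rewrite frog_walkE steps_sum0 addr0 => -[<-].
  by exists 0%N.
rewrite /=; case: (frog_age up t x) => [k|]; first by exists k.+1.
exists 0%N; case: asboolP => // -[]; exists 0%N, t.
by rewrite frog_age_origin.
Qed.

Lemma frog_visited_shift up t x k j : frog_age up t x = Some k ->
  frog_visited up (frog_walk up x (j + k)).
Proof. by move=> h; exists (j + t)%N, x, (j + k)%N; split=> //; exact: frog_age_step. Qed.

(* The past of the walk is covered as well: the induction on t goes back to the
   time at which frog x woke up, when its age was 0. *)
Lemma frog_visited_walk up t x k n : frog_age up t x = Some k ->
  frog_visited up (frog_walk up x n).
Proof.
elim: t k => [|t IH] k /=.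
  by case: eqP => // -> _; have := @frog_visited_shift up 0 0 0 n erefl; rewrite addn0.
move=> h; case e: (frog_age up t x) => [j|]; first exact: IH e.
move: (h); rewrite e; case: asboolP => // _ [k0].
have := @frog_visited_shift up t.+1 x 0 n; rewrite addn0; apply.
by move: h; rewrite -k0.
Qed.

(** An event on integers that stands in for the extended-real infimum in [frog_depth]; the
    inequality on [z] makes it meaningful also when the visited set is unbounded below. *)
Definition reaches (n : nat) (up : nat * nat -> bool) : Prop :=
  exists2 z : int, frog_visited up z & z <= - n%:Z.

(** Necessary condition, for the upper bound: it keeps only the walk of one frog and forgets whether
    that frog wakes. *)
Lemma reaches_hits n up : reaches n up ->
  exists x m, hits false (fun j => up (x, j)) m (n + x).
Proof.
move=> [z [t [x [k [_ <-]]]] h]; exists x, k; apply: steps_sum_hits.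
by move: h; rewrite frog_walkE; lia.
Qed.

(** Sufficient condition, for the lower bound: frog 0 gets to [x] and wakes frog [x], whose walk
    then goes down to [- n]. *)
Lemma hits_reaches n up x l m :
  hits true (fun j => up (0%N, j)) l x ->
  hits false (fun j => up (x, j)) m (n + x) -> reaches n up.
Proof.
move=> /hits_steps_sum[t ht] /hits_steps_sum[k hk].
have [|j hj] := @frog_wakes up t x; first by rewrite frog_walkE ht add0r.
exists (frog_walk up x k); first exact: frog_visited_walk hj.
by rewrite frog_walkE hk; lia.
Qed.

(** Visited sites are integers, so a depth above [r] means a visited site at or below minus the
    least integer greater than [r], which is [(Num.truncn r).+1] as [r] is nonnegative. *)
Lemma lt_frog_depth (R : realType) (r : R) up : 0 <= r ->
  (r%:E < frog_depth R up)%E <-> reaches (Num.truncn r).+1 up.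
Proof.
move=> r0; rewrite /frog_depth -lteNr -EFinN; split.
  move=> /ereal_inf_lt[_ [z vz <-]]; rewrite lte_fin => zr.
  exists z => //; move: zr vz; case: z => [z|z] zr vz.
    have z0 : (0 <= z%:R :> R) by exact: ler0n.
    by have := le_lt_trans z0 zr; rewrite oppr_gt0 ltNge r0.
  move: zr; rewrite NegzE mulrNz ltrN2 -pmulrn => zr.
  have : (Num.truncn r < z.+1)%N by rewrite truncn_lt_nat.
  by lia.
move=> [z vz zr]; apply: (@le_lt_trans _ _ (z%:~R)%:E).
  by apply: ereal_inf_lbound; exists z.
rewrite lte_fin; have /le_lt_trans : (z%:~R <= (- ((Num.truncn r).+1%:Z))%:~R :> R).
  by rewrite ler_int.
apply; rewrite mulrNz ltrN2 -pmulrn; exact: truncnS_gt.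
Qed.

(** * Hitting probabilities of the biased walk *)

(** First-step recursion for the probability of covering distance [k] within [n] steps. Here [a] is
    the probability of a step towards the target, so that one function serves both directions. *)
Fixpoint hit_prob (R : realType) (a : R) (n k : nat) : R :=
  match k, n with
  | 0, _ => 1
  | _, 0 => 0
  | k'.+1, n'.+1 => a * hit_prob a n' k' + (1 - a) * hit_prob a n' k.+1
  end.

Lemma hit_prob0 (R : realType) (a : R) n : hit_prob a n 0 = 1.
Proof. by case: n. Qed.

Lemma hit_prob_ge0 (R : realType) (a : R) n k : 0 <= a <= 1 ->
  0 <= hit_prob a n k.
Proof.
move=> /andP[a0 a1]; elim: n k => [|n IH] [|k] //=.
by rewrite addr_ge0 // mulr_ge0 ?subr_ge0.
Qed.

Lemma hit_prob_nd (R : realType) (a : R) k : 0 <= a <= 1 ->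
  {homo (fun n => hit_prob a n k) : m n / (m <= n)%N >-> m <= n}.
Proof.
move=> a01; apply/nondecreasing_seqP => n.
elim: n k => [|n IH] [|k] //; first exact: (@hit_prob_ge0 R a 1 k.+1).
rewrite [leLHS]/= [leRHS]/=; case/andP: a01 => a0 a1.
by apply: lerD; rewrite ler_wpM2l ?subr_ge0 // IH.
Qed.

(* The hypotheses say that t is harmonic for the walk stopped at 0. *)
Lemma hit_prob_le (R : realType) (a : R) (t : nat -> R) n k : 0 <= a <= 1 ->
  (forall k, 0 <= t k) -> t 0%N = 1 ->
  (forall k, t k.+1 = a * t k + (1 - a) * t k.+2) ->
  hit_prob a n k <= t k.
Proof.
move=> /andP[a0 a1] t0 t1 tS; elim: n k => [|n IH] [|k] /=; rewrite ?t1 //.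
by rewrite tS; apply: lerD; rewrite ler_wpM2l ?subr_ge0 // IH.
Qed.

(* The defect [t - lim hit_prob] is harmonic and vanishes at 0, so that its
   increments are geometric with ratio a / (1 - a); the growth condition on t
   forces the first increment to vanish. *)
Lemma hit_prob_cvg (R : realType) (a : R) (t : nat -> R) : 0 < a < 1 ->
  (forall k, 0 <= t k) -> t 0%N = 1 ->
  (forall k, t k.+1 = a * t k + (1 - a) * t k.+2) ->
  (forall c, 0 < c -> ~ forall k, c * \sum_(i < k) (a / (1 - a)) ^+ i <= t k) ->
  forall k, hit_prob a n k @[n --> \oo] --> t k.
Proof.
move=> a01 t0 t1 tS tgrow.
have [a0 a1] : 0 < a /\ 0 < 1 - a by case/andP: a01 => *; lra.
have a01' : 0 <= a <= 1 by case/andP: a01 => /ltW -> /ltW ->.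
have ndh k : nondecreasing_seq (fun n => hit_prob a n k) by exact: hit_prob_nd.
have ch k : cvgn (fun n => hit_prob a n k).
  by apply: nondecreasing_is_cvgn => //; exists (t k) => _ [n _ <-]; exact: hit_prob_le.
pose h k : R := limn (fun n => hit_prob a n k).
have hS k : h k.+1 = a * h k + (1 - a) * h k.+2.
  apply/cvg_lim => //; rewrite -cvg_shiftS /=.
  by apply: cvgD; apply: cvgMl_tmp; exact: ch.
have h0 : h 0%N = 1.
  by apply/cvg_lim => //; under eq_fun do rewrite hit_prob0; exact: cvg_cst.
have ht k : h k <= t k.
  by apply: limr_le => //; apply: nearW => n; exact: hit_prob_le.
have hge0 k : 0 <= h k.
  by apply: limr_ge => //; apply: nearW => n; exact: hit_prob_ge0.
pose f k := t k - h k; pose c := f 1%N.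
have df k : f k.+1 - f k = c * (a / (1 - a)) ^+ k.
  elim: k => [|k IH]; first by rewrite expr0 mulr1 /c /f t1 h0 subrr subr0.
  rewrite exprS mulrCA -IH.
  have E : (1 - a) * (f k.+2 - f k.+1) = a * (f k.+1 - f k).
    by rewrite /f; have := tS k; have := hS k; lra.
  by apply: (mulfI (lt0r_neq0 a1)); rewrite E; field; lra.
have fE k : f k = c * \sum_(i < k) (a / (1 - a)) ^+ i.
  elim: k => [|k IH]; first by rewrite big_ord0 /f t1 h0; lra.
  by rewrite big_ord_recr /= mulrDr -IH -df; lra.
have c0 : c = 0.
  apply/eqP; rewrite eq_le; apply/andP; split; last by rewrite subr_ge0.
  rewrite leNgt; apply/negP => /tgrow; apply => k; rewrite -fE.
  by rewrite /f lerBlDr lerDl.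
move=> k; suff -> : t k = h k by exact: ch.
by apply/eqP; rewrite -subr_eq0 -/(f k) fE c0 mul0r.
Qed.

Lemma hit_prob_up_cvg (R : realType) (rho : R) k : 0 < rho < 1 ->
  hit_prob (1 + rho)^-1 n k @[n --> \oo] --> (1 : R).
Proof.
move=> /andP[r0 r1]; have rE : 1 - (1 + rho)^-1 = rho / (1 + rho) by field; lra.
have p0 : 0 < (1 + rho)^-1 by rewrite invr_gt0; lra.
apply: (@hit_prob_cvg R _ (fun=> 1)) => //.
- by rewrite p0 invf_lt1; lra.
- by move=> _; rewrite !mulr1; lra.
(* The ratio is [rho^-1], so every term of the sum is at least 1, and more than [c^-1] terms push
   the product above 1. *)
move=> c c0 /(_ (Num.truncn c^-1).+1); rewrite leNgt => /negP; apply.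
have -> : (1 + rho)^-1 / (1 - (1 + rho)^-1) = rho^-1 by rewrite rE; field; lra.
rewrite mulrC -ltr_pdivrMr // mul1r.
apply: lt_le_trans (truncnS_gt _) _.
rewrite -[in leLHS](card_ord (Num.truncn c^-1).+1) -sumr_const ler_sum // => i _.
by rewrite exprn_ege1 // invf_ge1 // ltW.
Qed.

Lemma hit_prob_down_harmonic (R : realType) (rho : R) k : 0 < rho < 1 ->
  rho ^+ k.+1 =
    (1 - (1 + rho)^-1) * rho ^+ k + (1 - (1 - (1 + rho)^-1)) * rho ^+ k.+2.
Proof. by move=> /andP[r0 r1]; rewrite !exprS; field; lra. Qed.

Lemma hit_prob_down_le (R : realType) (rho : R) n k : 0 < rho < 1 ->
  hit_prob (1 - (1 + rho)^-1) n k <= rho ^+ k.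
Proof.
move=> r01; case/andP: (r01) => r0 r1.
have p0 : 0 < (1 + rho)^-1 by rewrite invr_gt0; lra.
have p1 : (1 + rho)^-1 < 1 by rewrite invf_lt1; lra.
apply: hit_prob_le => [| | |j]; [lra | | by [] |].
- by move=> j; rewrite exprn_ge0 // ltW.
- exact: hit_prob_down_harmonic.
Qed.

Lemma hit_prob_down_cvg (R : realType) (rho : R) k : 0 < rho < 1 ->
  hit_prob (1 - (1 + rho)^-1) n k @[n --> \oo] --> (rho ^+ k : R).
Proof.
move=> r01; case/andP: (r01) => r0 r1.
have p0 : 0 < (1 + rho)^-1 by rewrite invr_gt0; lra.
have p1 : (1 + rho)^-1 < 1 by rewrite invf_lt1; lra.
apply: (@hit_prob_cvg R _ (fun j => rho ^+ j)) => [| | |j|c c0 h] //; [lra | | |].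
- by move=> j; rewrite exprn_ge0 // ltW.
- exact: hit_prob_down_harmonic.
(* The term of index 0 of the sum is 1, hence [c <= rho ^+ n.+1] for all [n], and the right side
   tends to 0. *)
have : c <= 0; last by rewrite leNgt c0.
have : rho ^+ n.+1 @[n --> \oo] --> (0 : R).
  by have := @cvg_expr R rho; rewrite -cvg_shiftS; apply; rewrite gtr0_norm.
move=> /cvgr_to_ge; apply; apply: nearW => n.
apply: le_trans (h n.+1).
have q0 : 0 <= (1 - (1 + rho)^-1) / (1 - (1 - (1 + rho)^-1)).
  by rewrite ltW // divr_gt0 //; lra.
rewrite -[leLHS]mulr1 ler_pM2l // big_ord_recl expr0 lerDl sumr_ge0 // => i _.
exact: exprn_ge0.
Qed.

(** * Independent tosses *)

Section CoinTosses.
Context (R : realType) (d : measure_display) (T : measurableType d).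
Context (P : probability T R) (I : choiceType) (up : I -> {RV P >-> bool}).
Context (p : R).
Hypothesis up_ind : mutually_independent up.
Hypothesis up_prob : forall i, P (up i @^-1` [set true]) = p%:E.

Let coin_prob (b : bool) : R := if b then p else 1 - p.

Let cylinder (J : seq I) (v : I -> bool) : set T :=
  \bigcap_(i in [set` J]) (up i @^-1` [set v i]).

Lemma measurable_toss i b : measurable (up i @^-1` [set b]).
Proof. by rewrite -[X in measurable X]setTI; exact: measurable_funP. Qed.

Lemma toss_prob i b : P (up i @^-1` [set b]) = (coin_prob b)%:E.
Proof.
case: b; first exact: up_prob.
have -> : up i @^-1` [set false] = ~` (up i @^-1` [set true]).
  by apply/seteqP; split=> w /=; case: (up i w) => //= /(_ erefl).
by rewrite probability_setC ?up_prob //; exact: measurable_toss.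
Qed.

Lemma measurable_cylinder J v : measurable (cylinder J v).
Proof.
apply: fin_bigcap_measurable => [|i _]; first exact: finite_seq.
exact: measurable_toss.
Qed.

Lemma cylinder_cons i J v : i \notin J -> uniq J ->
  P (cylinder (i :: J) v) = ((coin_prob (v i))%:E * P (cylinder J v))%E.
Proof.
move=> iJ uJ; rewrite /cylinder.
by rewrite !(up_ind (A := fun i => [set v i])) //= ?iJ // big_cons toss_prob.
Qed.

(* The event E has probability e and is independent of every finite family of
   tosses taken outside S. *)
Definition determined_by (S : set I) (E : set T) (e : R) : Prop :=
  measurable E /\
  forall J v, uniq J -> (forall i, i \in J -> ~ S i) ->
    P (cylinder J v `&` E) = (P (cylinder J v) * e%:E)%E.

Lemma determined_prob S E e : determined_by S E e -> P E = e%:E.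
Proof.
move=> [mE h]; have := h [::] xpredT erefl (fun i => ltac:(by [])).
by rewrite /cylinder set_nil bigcap_set0 setTI probability_setT mul1e.
Qed.

Lemma determined_weaken S S' E E' e e' :
  determined_by S E e -> S `<=` S' -> E = E' -> e = e' -> determined_by S' E' e'.
Proof.
move=> [mE h] SS' <- <-; split=> // J v uJ JS; apply: h => // i /JS nS' Si.
exact/nS'/SS'.
Qed.

Lemma determined_set0 S : determined_by S set0 0.
Proof. by split=> // J v _ _; rewrite setI0 measure0 mule0. Qed.

Lemma determined_setT S : determined_by S setT 1.
Proof. by split=> // J v _ _; rewrite setIT mule1. Qed.

(** Condition on toss [i]: since [i] is outside [S], that toss can be added to the cylinder, and the
    product rules of [E1] and [E2] apply to the enlarged cylinder. *)
Lemma determined_branch S i E1 e1 E2 e2 : ~ S i ->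
  determined_by S E1 e1 -> determined_by S E2 e2 ->
  determined_by (i |` S) [set w | if up i w then E1 w else E2 w]
    (p * e1 + (1 - p) * e2).
Proof.
move=> Si [m1 h1] [m2 h2].
set E := [set w | _].
have EE : E = (up i @^-1` [set true] `&` E1) `|` (up i @^-1` [set false] `&` E2).
  apply/seteqP; split=> w; rewrite /E /=.
    by case: (up i w) => h; [left|right].
  by case=> -[-> ].
split=> [|J v uJ JS].
  by rewrite EE; apply: measurableU; apply: measurableI => //; exact: measurable_toss.
have iJ : i \notin J by apply/negP => /JS; apply; left.
have JnS j : j \in J -> ~ S j by move=> /JS nS Sj; apply: nS; right.
(* The pattern [v] may prescribe any value at [i]; [v'] overrides it with the outcome [b] and agrees
   with [v] on [J]. *)
pose v' b j := if j == i then b else v j.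
have cE b : cylinder (i :: J) (v' b) = up i @^-1` [set b] `&` cylinder J v.
  rewrite /cylinder !bigcap_seq big_cons /v' eqxx; congr (_ `&` _).
  by apply: eq_big_seq => j jJ; case: eqP jJ iJ => // -> ->.
have pE b E' e' : (forall J v, uniq J -> (forall i, i \in J -> ~ S i) ->
    P (cylinder J v `&` E') = (P (cylinder J v) * e'%:E)%E) ->
    P (cylinder J v `&` (up i @^-1` [set b] `&` E')) =
    (P (cylinder J v) * (coin_prob b * e')%:E)%E.
  move=> h'; rewrite setIA [X in X `&` _]setIC -cE h' /= ?iJ //.
    rewrite cylinder_cons //.
    have -> : cylinder J (v' b) = cylinder J v.
      by apply: eq_bigcapr => j /= jJ; rewrite /v'; case: eqP jJ iJ => // -> ->.
    by rewrite /v' eqxx EFinM muleAC muleC.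
  by move=> j; rewrite inE => /predU1P[->|] //; exact: JnS.
rewrite EE setIUr measureU.
- apply: etrans (congr2 _ (pE true _ _ h1) (pE false _ _ h2)) _.
  by rewrite -muleDr // fin_num_measure //; exact: measurable_cylinder.
- apply: measurableI; first exact: measurable_cylinder.
  by apply: measurableI => //; exact: measurable_toss.
- apply: measurableI; first exact: measurable_cylinder.
  by apply: measurableI => //; exact: measurable_toss.
- by apply/seteqP; split=> w //= [[_ [-> _]]] [_ []].
Qed.

End CoinTosses.

(** * Law of the leftmost visited site *)

(** Weierstrass product inequality, which acts as a union bound for independent events. *)
Lemma prod_subr_ge (R : realDomainType) (I : Type) (s : seq I) (a : I -> R) :
  (forall i, 0 <= a i <= 1) ->
  0 <= \prod_(i <- s) (1 - a i) <= 1 /\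
  1 - \sum_(i <- s) a i <= \prod_(i <- s) (1 - a i).
Proof.
move=> a01; elim: s => [|i s [/andP[p0 p1] h]]; first by rewrite !big_nil; split; lra.
by rewrite !big_cons; have /andP[i0 i1] := a01 i; split; nra.
Qed.

(** Companion inequality, resting on [(1 - a) * (1 + a) <= 1]; it shows that the product is small
    when the sum is large. *)
Lemma prod_subr_le (R : realFieldType) (I : Type) (s : seq I) (a : I -> R) :
  (forall i, 0 <= a i <= 1) ->
  \prod_(i <- s) (1 - a i) <= (1 + \sum_(i <- s) a i)^-1.
Proof.
move=> a01; have s0 r : 0 <= \sum_(i <- r) a i.
  by apply: sumr_ge0 => i _; case/andP: (a01 i).
rewrite -[leRHS]mul1r ler_pdivlMr; last by rewrite ltr_pwDl.
elim: s => [|i s]; first by rewrite !big_nil; lra.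
have [/andP[p0 p1] _] := prod_subr_ge s a01.
have := s0 s; have /andP[i0 i1] := a01 i; rewrite !big_cons.
set u := \sum_(j <- s) _; set v := \prod_(j <- s) _ in p0 p1 *.
move=> u0 h; have : v * (1 + u) * (1 - a i) <= 1 - a i by rewrite ler_piMl //; lra.
(* Expanding the new product leaves the term [- v * a i ^+ 2], whose sign is supplied here. *)
have := mulr_ge0 p0 (mulr_ge0 i0 i0); nra.
Qed.

Lemma sum_geometric (R : fieldType) (r : R) n L : r != 1 ->
  \sum_(0 <= x < L) r ^+ (n + x) = r ^+ n / (1 - r) * (1 - r ^+ L).
Proof.
move=> r1; have r1' : 1 - r != 0 by rewrite subr_eq0 eq_sym.
elim: L => [|L IH]; first by rewrite big_geq // expr0 subrr mulr0.
by rewrite big_nat_recr //= IH exprD exprS; field.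
Qed.

Section Frogs.
Context (R : realType) (d : measure_display) (T : measurableType d).
Context (P : probability T R) (rho : R) (up : nat * nat -> {RV P >-> bool}).
Hypothesis rho01 : 0 < rho < 1.
Hypothesis up_steps : frog_steps rho up.

Let walk_bits (x : nat) (w : T) (j : nat) : bool := up (x, j) w.

Let toward (b : bool) : R := if b then (1 + rho)^-1 else 1 - (1 + rho)^-1.

Let toward_bounds b : 0 <= toward b <= 1.
Proof.
case/andP: rho01 => r0 r1.
have p0 : 0 < (1 + rho)^-1 by rewrite invr_gt0; lra.
have p1 : (1 + rho)^-1 < 1 by rewrite invf_lt1; lra.
by rewrite /toward; case: b; lra.
Qed.

Lemma hit_prob_bounds b n k : 0 <= hit_prob (toward b) n k <= 1.
Proof.
rewrite hit_prob_ge0 //=; apply: (@hit_prob_le _ _ (fun=> 1)) => // *; lra.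
Qed.

(** The event [E] about other tosses is carried through the induction, so the hitting law of frog
    [x] and its independence from [E] come out together. The offset [j] is the number of tosses of
    frog [x] already used. *)
Lemma no_hit_determined b x j n k S E r :
  (forall i, (j <= i)%N -> ~ S (x, i)) -> determined_by up S E r ->
  determined_by up (S `|` [set i | i.1 = x /\ (j <= i.2)%N])
    [set w | ~~ hits b (fun i => walk_bits x w (j + i)) n k /\ E w]
    ((1 - hit_prob (toward b) n k) * r).
Proof.
(* Distance 0 is always covered: the event is empty, and the factor [1 - hit_prob] is [1 - 1]. *)
have none S' E' : E' `<=` set0 -> determined_by up S' E' ((1 - 1) * r).
  move=> E'0; apply: determined_weaken (determined_set0 up S') _ _ _ => //.
  - by apply/seteqP; split.
  - by rewrite subrr mul0r.
move=> + dE; elim: n j k => [|n IH] j [|k] Sx;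
  [by apply: none => w [] | | by apply: none => w [] |].
  apply: determined_weaken dE _ _ _ => /=.
  - by left.
  - by apply/seteqP; split=> w // [].
  - by rewrite subr0 mul1r.
have Sx' i : (j.+1 <= i)%N -> ~ S (x, i) by move=> /ltnW /Sx.
set S' := S `|` [set i | i.1 = x /\ (j.+1 <= i.2)%N].
have S'j : ~ S' (x, j) by move=> [/Sx|[_]] /=; [exact|rewrite ltnn].
(* The distance is [k.+1] before this toss; a step in direction [b] leaves [k], the other one leaves
   [k.+2]. *)
have D := determined_branch up_steps.1 up_steps.2 S'j
   (IH _ (if true == b then k else k.+2) Sx') (IH _ (if false == b then k else k.+2) Sx').
apply: determined_weaken D _ _ _.
- move=> i [->|[|[ix ji]]]; [by right| by left |].
  by right; split=> //; exact: ltnW.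
- apply/seteqP; split=> w /=; rewrite addn0 {2 4}/walk_bits;
    under [fun i => walk_bits x w (j + i.+1)]eq_fun do rewrite addnS -addSn;
    by case: (up (x, j) w).
- by case: b {IH none} => /=; ring.
Qed.

Lemma no_hits_determined b n (k : nat -> nat) (xs : seq nat) : uniq xs ->
  determined_by up [set i | i.1 \in xs]
    [set w | all (fun x => ~~ hits b (walk_bits x w) n (k x)) xs]
    (\prod_(x <- xs) (1 - hit_prob (toward b) n (k x))).
Proof.
elim: xs => [_|x xs IH /= /andP[xxs uxs]].
  rewrite big_nil; apply: determined_weaken (determined_setT up set0) _ _ _ => //.
  by apply/seteqP; split.
have D := @no_hit_determined b x 0 n (k x) _ _ _ _ (IH uxs).
apply: determined_weaken (D _) _ _ _.
- by move=> i _ /=; apply/negP.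
- by move=> i [/= ix|[/= -> _]]; rewrite inE ?ix ?eqxx ?orbT.
- by apply/seteqP; split=> w /= => [[-> ->]|/andP].
- by rewrite big_cons.
Qed.

Lemma no_hits_prob b n (k : nat -> nat) (xs : seq nat) : uniq xs ->
  P [set w | all (fun x => ~~ hits b (walk_bits x w) n (k x)) xs] =
  (\prod_(x <- xs) (1 - hit_prob (toward b) n (k x)))%:E.
Proof. by move=> /(no_hits_determined b n k) /determined_prob. Qed.

Lemma measurable_no_hits b n (k : nat -> nat) (xs : seq nat) : uniq xs ->
  measurable [set w | all (fun x => ~~ hits b (walk_bits x w) n (k x)) xs].
Proof. by move=> /(no_hits_determined b n k) []. Qed.

(** All sets [A] are treated at once because removing the last step shifts [A] by one. *)
Lemma measurable_steps_sum x k (A : set int) :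
  measurable [set w | A (steps_sum (walk_bits x w) k)].
Proof.
elim: k A => [|k IH] A.
  under [X in measurable X]eq_set => w do rewrite steps_sum0.
  have [A0|nA0] := pselect (A 0).
    by rewrite (_ : mkset _ = setT) //; apply/seteqP; split.
  by rewrite (_ : mkset _ = set0) //; apply/seteqP; split.
rewrite (_ : mkset _ =
   (up (x, k) @^-1` [set true] `&` [set w | A (steps_sum (walk_bits x w) k + 1)]) `|`
   (up (x, k) @^-1` [set false] `&` [set w | A (steps_sum (walk_bits x w) k - 1)])).
  apply: measurableU; apply: measurableI; first exact: measurable_toss.
  - exact: (IH [set z | A (z + 1)]).
  - exact: measurable_toss.
  - exact: (IH [set z | A (z - 1)]).
apply/seteqP; split=> w /=; rewrite /steps_sum big_ord_recr /=
  -[up (x, k) w]/(walk_bits x w k).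
  by case: (walk_bits x w k) => h; [left|right].
by case=> -[-> ].
Qed.

Let ups w := fun i => up i w.

Lemma measurable_frog_walk x k (A : set int) :
  measurable [set w | A (frog_walk (ups w) x k)].
Proof. exact: (measurable_steps_sum x k [set z | A (x%:Z + z)]). Qed.

Lemma measurable_frog_age t x k :
  measurable [set w | frog_age (ups w) t x = Some k].
Proof.
elim: t x k => [|t IH] x k /=.
  case: eqP => _; last by rewrite (_ : mkset _ = set0) //; apply/seteqP; split.
  case: k => [|k]; first by rewrite (_ : mkset _ = setT) //; apply/seteqP; split.
  by rewrite (_ : mkset _ = set0) //; apply/seteqP; split.
case: k => [|k].
  (* Age 0 at time [t.+1] means asleep at time [t], the complement of all ages, and met by some frog
     taking its next step. *)
  rewrite (_ : mkset _ =
    ~` (\bigcup_k [set w | frog_age (ups w) t x = Some k]) `&`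
    \bigcup_y \bigcup_j ([set w | frog_age (ups w) t y = Some j] `&`
       [set w | frog_walk (ups w) y j.+1 = x%:Z])).
    apply: measurableI.
      by apply: measurableC; apply: bigcupT_measurable => j; exact: IH.
    apply: bigcupT_measurable => y; apply: bigcupT_measurable => j.
    apply: measurableI; first exact: IH.
    exact: (measurable_frog_walk y j.+1 [set x%:Z]).
  apply/seteqP; split=> w /=.
    case e: (frog_age (ups w) t x) => [j|] //; case: asboolP => // -[y [j [h1 h2]]] _.
    by split; [move=> [j' _]; rewrite /= e | exists y => //; exists j].
  case=> h [y _ [j _ [h1 h2]]]; case e: (frog_age (ups w) t x) => [j'|].
    by exfalso; apply: h; exists j'.
  by case: asboolP => // -[]; exists y, j.
rewrite (_ : mkset _ = [set w | frog_age (ups w) t x = Some k]); first exact: IH.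
apply/seteqP; split=> w /=; case: (frog_age (ups w) t x) => [j|] //.
- by move=> [->].
- by case: asboolP.
- by move=> [->].
Qed.

Lemma measurable_reaches n : measurable [set w | reaches n (ups w)].
Proof.
rewrite (_ : mkset _ = \bigcup_t \bigcup_x \bigcup_k
   ([set w | frog_age (ups w) t x = Some k] `&`
    [set w | frog_walk (ups w) x k <= - n%:Z])).
  do 3!(apply: bigcupT_measurable => ?).
  apply: measurableI; first exact: measurable_frog_age.
  exact: (measurable_frog_walk _ _ [set z | z <= - n%:Z]).
apply/seteqP; split=> w /=.
  by move=> [z [t [x [k [h <-]]]] hz]; exists t => //; exists x => //; exists k.
by move=> [t _ [x _ [k _ [h hz]]]]; exists (frog_walk (ups w) x k) => //; exists t, x, k.
Qed.


(** The first [L] frogs with [L] steps each give increasing events [U L] whose union contains the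
    event. Each has probability at most the geometric sum of [rho ^+ (n + x)], and continuity from
    below passes this bound to the union. *)
Lemma reaches_prob_le n :
  (P [set w | reaches n (ups w)] <= (rho ^+ n / (1 - rho))%:E)%E.
Proof.
case/andP: (rho01) => r0 r1.
pose U L := ~` [set w |
  all (fun x => ~~ hits false (walk_bits x w) L (n + x)) (index_iota 0 L)].
have mU L : measurable (U L).
  by apply: measurableC; apply: measurable_no_hits; exact: iota_uniq.
have UE L w : U L w <->
    exists2 x, (x < L)%N & hits false (walk_bits x w) L (n + x).
  rewrite /U /=; split=> [/negP/allPn[x]|[x xL h] /allP/(_ x)].
    by rewrite mem_index_iota negbK => /= xL h; exists x.
  by rewrite mem_index_iota h => /(_ xL).
have ndU : nondecreasing_seq U.
  move=> L M LM; apply/subsetPset => w /UE[x xL h]; apply/UE; exists x.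
    exact: leq_trans xL LM.
  exact: hits_le h.
have sU : [set w | reaches n (ups w)] `<=` \bigcup_L U L.
  move=> w /reaches_hits[x [m h]]; exists (maxn x.+1 m) => //; apply/UE; exists x.
    by rewrite leq_max leqnn.
  by apply: hits_le h; rewrite leq_maxr.
have mbU : measurable (\bigcup_L U L) by exact: bigcupT_measurable.
have PU L : (P (U L) <= (rho ^+ n / (1 - rho))%:E)%E.
  rewrite probability_setC; last by apply: measurable_no_hits; exact: iota_uniq.
  rewrite no_hits_prob ?iota_uniq // -EFinD lee_fin.
  have [_] := prod_subr_ge (index_iota 0 L) (fun x => hit_prob_bounds false L (n + x)).
  rewrite lerBlDr -lerBlDl => /le_trans; apply.
  apply: (@le_trans _ _ (\sum_(0 <= x < L) rho ^+ (n + x))).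
    by apply: ler_sum => x _; exact: hit_prob_down_le.
  rewrite sum_geometric ?lt_eqF // ler_piMr //.
    by rewrite divr_ge0 ?exprn_ge0 ?subr_ge0 // ltW.
  by rewrite gerBl exprn_ge0 // ltW.
apply: le_trans (le_measure P _ _ sU) _; rewrite ?inE //; first exact: measurable_reaches.
exact: (cvge_to_le (nondecreasing_cvg_mu mU mbU ndU) (nearW _ PU)).
Qed.

(** The complement is bounded using [L] frogs with [N] steps each; first [N] tends to infinity at
    fixed [L], then [L] does. *)
Lemma reaches_prob_ge n :
  ((1 - (1 - rho) / rho ^+ n)%:E <= P [set w | reaches n (ups w)])%E.
Proof.
case/andP: (rho01) => r0 r1.
have mV := measurable_reaches n.
have bound L N : (P (~` [set w | reaches n (ups w)]) <=
    ((1 - hit_prob (toward true) N L) +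
     (1 + \sum_(0 <= x < L) hit_prob (toward false) N (n + x))^-1)%:E)%E.
  pose A := [set w | all (fun x => ~~ hits true (walk_bits x w) N L) [:: 0%N]].
  pose B := [set w |
    all (fun x => ~~ hits false (walk_bits x w) N (n + x)) (index_iota 0 L)].
  have mA : measurable A by exact: measurable_no_hits.
  have mB : measurable B by apply: measurable_no_hits; exact: iota_uniq.
  (* If the depth is not reached, either frog 0 fails to get to [L], or it wakes all frogs below [L]
     and none of them goes far enough. Both events involve frog 0, so their probabilities are added
     rather than multiplied. *)
  have sAB : ~` [set w | reaches n (ups w)] `<=` A `|` B.
    move=> w nV; have [h|nh] := boolP (hits true (walk_bits 0 w) N L); last first.
      by left; rewrite /A /= nh.
    right; rewrite /B /=; apply/allP => x; rewrite mem_index_iota /= => xL.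
    apply/negP => hx; apply: nV; apply: hits_reaches hx.
    exact: hits_lower (ltnW xL) h.
  apply: le_trans (le_measure P _ _ sAB) _; rewrite ?inE; [exact: measurableC|exact: measurableU|].
  apply: le_trans (measureU2 _ mA mB) _.
  have PA : P A = _ := @no_hits_prob true N (fun=> L) [:: 0%N] erefl.
  have PB : P B = _ :=
    @no_hits_prob false N (addn n) (index_iota 0 L) (iota_uniq _ _).
  rewrite [leLHS](congr2 _ PA PB) big_seq1 -EFinD lee_fin lerD2l.
  by apply: prod_subr_le => x; exact: hit_prob_bounds.
have PCE : P (~` [set w | reaches n (ups w)]) =
    (fine (P (~` [set w | reaches n (ups w)])))%:E.
  by rewrite fineK // fin_num_measure //; exact: measurableC.
have boundL L : fine (P (~` [set w | reaches n (ups w)])) <=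
    (1 + rho ^+ n / (1 - rho) * (1 - rho ^+ L))^-1.
  rewrite -sum_geometric ?lt_eqF //.
  have lim : ((1 - hit_prob (toward true) N L) +
     (1 + \sum_(0 <= x < L) hit_prob (toward false) N (n + x))^-1) @[N --> \oo] -->
     (1 - 1) + (1 + \sum_(0 <= x < L) rho ^+ (n + x))^-1.
    apply: cvgD; first by apply: cvgB; [exact: cvg_cst|exact: hit_prob_up_cvg].
    apply: cvgV.
      rewrite gt_eqF // ltr_pwDl // sumr_ge0 // => x _.
      by rewrite exprn_ge0 // ltW.
    apply: cvgD; first exact: cvg_cst.
    elim: L {bound} => [|L IH].
      by under eq_fun do rewrite big_geq //; rewrite big_geq //; exact: cvg_cst.
    under eq_fun do rewrite big_nat_recr //=; rewrite big_nat_recr //=.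
    by apply: cvgD => //; exact: hit_prob_down_cvg.
  move: lim; rewrite subrr add0r => /cvgr_to_ge; apply; apply: nearW => N.
  by rewrite -lee_fin -PCE; exact: bound.
have key : fine (P (~` [set w | reaches n (ups w)])) <= (1 - rho) / rho ^+ n.
  have q0 : 0 < rho ^+ n / (1 - rho) by rewrite divr_gt0 ?exprn_gt0 ?subr_gt0.
  have lim : (1 + rho ^+ n / (1 - rho) * (1 - rho ^+ L))^-1 @[L --> \oo] -->
      (1 + rho ^+ n / (1 - rho) * (1 - 0))^-1.
    apply: cvgV; first by rewrite gt_eqF // subr0 mulr1 addr_gt0.
    apply: cvgD; first exact: cvg_cst.
    apply: cvgMl_tmp; apply: cvgB; first exact: cvg_cst.
    by apply: cvg_expr; rewrite gtr0_norm.
  apply: (@le_trans _ _ (1 + rho ^+ n / (1 - rho) * (1 - 0))^-1).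
    by move: lim => /cvgr_to_ge; apply; exact: nearW.
  (* With [S = rho ^+ n / (1 - rho)], this is [(1 + S)^-1 <= S^-1]. *)
  rewrite subr0 mulr1 -[leRHS]invf_div lef_pV2 ?posrE ?addr_gt0 //.
  by rewrite lerDr.
rewrite -[X in P X]setCK probability_setC; last exact: measurableC.
by rewrite PCE -EFinD lee_fin lerD2l lerN2.
Qed.

End Frogs.

(** * Concentration *)

(** The exponent [s] solves [rho]^ s = (1 - rho) [^ c]; the integer used lies in []s, s + 1]], and
    rounding up costs at most one factor [rho]. *)
Lemma expr_truncn_bounds (R : realType) (rho c : R) : 0 < rho < 1 -> 0 <= c ->
  rho * (1 - rho) `^ c <=
    rho ^+ (Num.truncn (c / (ln rho / ln (1 - rho)))).+1 <= (1 - rho) `^ c.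
Proof.
move=> /andP[r0 r1] c0.
have lr : ln rho < 0 by rewrite ln_lt0 // r0.
have l1r : ln (1 - rho) < 0 by rewrite ln_lt0 //; lra.
set s := c / _.
have s0 : 0 <= s by rewrite divr_ge0 // ltW // nmulr_rgt0 // invr_lt0.
have -> : (1 - rho) `^ c = rho `^ s.
  rewrite /powR !gt_eqF ?subr_gt0 //; congr expR; rewrite /s.
  by field; rewrite !lt_eqF.
have [ts st] := andP (truncn_itv s0).
rewrite -(powR_mulrn _ (ltW r0)); apply/andP; split; last first.
  by apply: ger_powR; [rewrite r0 ltW|exact: ltW].
rewrite powR_mulrn ?(ltW r0) // exprS ler_pM2l // -powR_mulrn ?(ltW r0) //.
by apply: ger_powR; rewrite ?r0 ?(ltW r1).
Qed.

Theorem theorem6 (R : realType)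
    (d : R -> measure_display) (T : forall rho : R, measurableType (d rho))
    (P : forall rho : R, probability (T rho) R)
    (up : forall rho : R, nat * nat -> {RV (P rho) >-> bool})
    (d' : R -> measure_display) (T' : forall rho : R, measurableType (d' rho))
    (Q : forall rho : R, probability (T' rho) R)
    (Y : forall rho : R, {RV (Q rho) >-> \bar R})
    (up_steps : forall rho : R, 0 < rho < 1 -> frog_steps rho (up rho))
    (Y_law : forall rho : R, 0 < rho < 1 ->
       same_law (Q rho) (P rho) (Y rho)
         (fun w => ((ln rho / ln (1 - rho))%:E *
                    frog_depth R (fun i => up rho i w))%E))
    (eps : R) (eps_gt0 : 0 < eps) :
  Q rho [set w | (eps%:E < `| Y rho w - 1%:E |)%E] @[rho --> 1^'-] --> 0%E.
Proof.
(* Capping at 1 keeps the lower threshold [1 - e] nonnegative, as [tail] requires. *)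
pose e := Num.min eps 1.
have [e0 e1 ee] : [/\ 0 < e, e <= 1 & e <= eps].
  by rewrite lt_min eps_gt0 ltr01 !ge_min !lexx orbT.
have tail rho c : 0 < rho < 1 -> 0 <= c ->
    Q rho [set w | (c%:E < Y rho w)%E] = P rho [set w |
      reaches (Num.truncn (c / (ln rho / ln (1 - rho)))).+1 (fun i => up rho i w)].
  move=> r01 c0; have /andP[r0 r1] := r01.
  have a0 : 0 < ln rho / ln (1 - rho).
    by rewrite nmulr_rgt0 ?invr_lt0 ln_lt0 //; lra.
  have := Y_law rho r01 `]c%:E, +oo[%classic (emeasurable_itv _).
  rewrite /pushforward => h.
  rewrite (_ : [set w | _] = Y rho @^-1` `]c%:E, +oo[%classic); last first.
    by apply/seteqP; split=> w /=; rewrite in_itv /= andbT.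
  rewrite h; congr (P rho _).
  have s0 : 0 <= c / (ln rho / ln (1 - rho)) by rewrite divr_ge0 // ltW.
  apply/seteqP; split=> w /=;
    rewrite in_itv /= andbT -lte_pdivrMl // -EFinM [_ * c]mulrC;
    by move=> /(lt_frog_depth _ s0).
(* The constant 3 is 1 for the upper tail plus 2 for the lower tail, where [rho > 2^-1] bounds
   [rho^-1] by 2. *)
have bound rho : 2^-1 < rho < 1 ->
    (Q rho [set w | (eps%:E < `| Y rho w - 1%:E |)%E] <= (3 * (1 - rho) `^ e)%:E)%E.
  move=> /andP[r2 r1]; have r0 : 0 < rho by lra.
  have r01 : 0 < rho < 1 by rewrite r0.
  have r21 : 1 <= 2 * rho by lra.
  have mY (D : set (\bar R)) : measurable D -> measurable (Y rho @^-1` D).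
    by move=> mD; rewrite -[X in measurable X]setTI; exact: measurable_funP.
  have mgt c : measurable [set w | (c%:E < Y rho w)%E].
    rewrite (_ : mkset _ = Y rho @^-1` `]c%:E, +oo[%classic).
      by apply: mY; exact: emeasurable_itv.
    by apply/seteqP; split=> w /=; rewrite in_itv /= andbT.
  have mdist : measurable [set w | (eps%:E < `| Y rho w - 1%:E |)%E].
    rewrite (_ : mkset _ = Y rho @^-1` [set y | (eps%:E < `|y - 1%:E|)%E]) //.
    apply: mY; rewrite -[X in measurable X]setTI.
    apply: emeasurable_fun_o_infty => //; apply: measurableT_comp => //.
    exact: emeasurable_funB.
  have sub : [set w | (eps%:E < `| Y rho w - 1%:E |)%E] `<=`
      [set w | ((1 + e)%:E < Y rho w)%E] `|` ~` [set w | ((1 - e)%:E < Y rho w)%E].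
    move=> w /=; case: (Y rho w) => [y||] /=.
    - rewrite !lte_fin => h.
      have [h1|h1] := ltrP (1 + e) y; [by left|right; apply/negP; rewrite -leNgt].
      by move: h; rewrite lter_normr => /orP[]; lra.
    - by left; rewrite ltry.
    - by right; rewrite ltNge leNye.
  apply: le_trans (le_measure (Q rho) _ _ sub) _; rewrite ?inE //.
    by apply: measurableU => //; exact: measurableC.
  apply: le_trans (measureU2 _ _ _) _ => //; first exact: measurableC.
  have p0 : 0 < (1 - rho) `^ e by apply: powR_gt0; rewrite subr_gt0.
  have q0 : 0 < 1 - rho by rewrite subr_gt0.
  have pD x y : (1 - rho) `^ (x + y) = (1 - rho) `^ x * (1 - rho) `^ y.
    by rewrite powRD //; apply/implyP => _; rewrite gt_eqF.
  have split3 : 3 * (1 - rho) `^ e = (1 - rho) `^ e + 2 * (1 - rho) `^ e by lra.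
  rewrite split3 [leRHS]EFinD; apply: leeD.
    (* Upper tail: the power of [rho] is at most [(1 - rho)]^ (1 + e)[, and dividing by]1 -
       rho[leaves](1 - rho) [^ e]. *)
    have c0 : 0 <= 1 + e by lra.
    rewrite [leLHS](tail _ _ r01 c0).
    apply: le_trans (reaches_prob_le r01 (up_steps _ r01) _) _.
    rewrite lee_fin ler_pdivrMr //.
    have /andP[_ /le_trans] := expr_truncn_bounds r01 c0; apply.
    by rewrite pD (powRr1 (ltW q0)) mulrC.
  (* Lower tail: [rho ^+ m] is at least [rho * (1 - rho)]^ (1 - e)[, so](1 - rho) / rho ^+
     m[is at most](1 - rho) [^ e / rho]. *)
  have c0 : 0 <= 1 - e by lra.
  rewrite [leLHS](probability_setC (Q rho) (mgt _)) [X in (_ - X)%E](tail _ _ r01 c0).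
  have /andP[] := expr_truncn_bounds r01 c0.
  set m := _.+1 => hm _.
  have hV := reaches_prob_ge r01 (up_steps _ r01) m.
  apply: (@le_trans _ _ ((1 - rho) / rho ^+ m)%:E).
    rewrite leeBlDr; last by rewrite fin_num_measure //; exact: measurable_reaches.
    by move: hV; rewrite EFinB leeBlDr // addeC.
  rewrite lee_fin ler_pdivrMr ?exprn_gt0 //.
  have E1 : 1 - rho = (1 - rho) `^ (1 - e) * (1 - rho) `^ e.
    by rewrite -pD subrK (powRr1 (ltW q0)).
  rewrite [leLHS]E1.
  set u := (1 - rho) `^ e in p0 *; set v := _ `^ _ in hm *.
  have v0 : 0 <= v by exact: powR_ge0.
  rewrite [leRHS]mulrAC ler_pM2r //; apply: (@le_trans _ _ (2 * (rho * v))).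
    by rewrite mulrA ler_peMl.
  by rewrite ler_pM2l.
apply: (@squeeze_cvge _ _ _ _ (fun=> 0%E) _ (fun rho => (3 * (1 - rho) `^ e)%:E)).
- near=> rho; rewrite measure_ge0 bound //; apply/andP; split=> //.
  by near: rho; apply: nbhs_left_gt; lra.
- exact: cvg_cst.
- apply: cvg_EFin; first by apply: nearW.
  rewrite -[X in _ --> X](mulr0 3); apply: cvgMl_tmp.
  apply: (cvg_comp _ _ _ (powR_cvg0 e0)).
  (* As [rho] tends to 1 from the left, [1 - rho] tends to 0 from the right, where [powR_cvg0]
     applies. *)
  move=> A [r /= r0 rA]; exists r => //= x; rewrite /ball_ /= => xr x1.
  by apply: rA; rewrite /ball_ /= ?subr_gt0 // sub0r normrN.
Unshelve. all: by end_near. Qed.
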